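(* Let $\mathrm{P}_1,\dots,\mathrm{P}_q$ be independent random variables such that $\mathrm{P}_c$ follows a beta distribution $\beta(\alpha_c,\gamma_c)$ with $\alpha_c,\gamma_c>0$, $c=1,\dots,q$. Then the unconditional expected efficiency score, denoted $E_\beta(\Theta_0)$ in this case, is $$E_\beta(\Theta_0)=\sum_{b\in\{0,1\}^q}\frac{\prod_{c=1}^q\alpha_c^{b_c}\,\prod_{c=1}^q\gamma_c^{1-b_c}}{\prod_{c=1}^q(\alpha_c+\gamma_c)}\;\theta_0^b .$$
   Context: Setting: $n$ decision making units (DMUs) are described by nonnegative input and output data $x_{ij}$, $y_{rj}$. The (CCR) DEA efficiency score of $DMU_0$ is the optimal value of the linear program: minimize $\theta_0$ subject to $\sum_{j=1}^n\lambda_jx_{ij}\le\theta_0x_{i0}$ for every included input $i$, $\sum_{j=1}^n\lambda_jy_{rj}\ge y_{r0}$ for every included output $r$, and $\lambda_j\ge0$ for all $j$. There are $q\ge1$ candidate variables $z_1,\dots,z_q$, each an input or an output. For $b\in\{0,1\}^q$, $\theta_0^b$ is the (real) score of $DMU_0$ when exactly the candidates $z_c$ with $b_c=1$ are included; by convention $\theta_0^{(0,\dots,0)}=1$. $\Theta_0$ is the random score that takes the value $\theta_0^b$ in scenario $b$; $\{\Theta_0=\theta_0^b\}$ denotes the scenario $b$ (scenarios are counted separately even if scores coincide). The selection probabilities are random: given $\mathrm{P}=(\mathrm{P}_1,\dots,\mathrm{P}_q)=\mathrm{p}$, candidates are included independently, $z_c$ with probability $\mathrm{p}_c$, so $P(\Theta_0=\theta_0^b\mid\mathrm{P}=\mathrm{p})=\prod_{c=1}^q\mathrm{p}_c^{b_c}(1-\mathrm{p}_c)^{1-b_c}$.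 If $f$ is the joint density of $\mathrm{P}$ (the product of the densities of the $\mathrm{P}_c$), the unconditional probability function of $\Theta_0$ is defined by $P(\Theta_0=\theta_0^b)=\int_{[0,1]^q}P(\Theta_0=\theta_0^b\mid\mathrm{P}=\mathrm{p})f(\mathrm{p})\,d\mathrm{p}$, and the unconditional expected efficiency score is defined by $E(\Theta_0)=\sum_{b\in\{0,1\}^q}\theta_0^b\,P(\Theta_0=\theta_0^b)$. The distribution $\beta(\alpha,\gamma)$ has density $\frac{\Gamma(\alpha+\gamma)}{\Gamma(\alpha)\Gamma(\gamma)}t^{\alpha-1}(1-t)^{\gamma-1}$ on $[0,1]$. *)

(* Defs.v *)
From HB Require Import structures.
From mathcomp Require Import all_boot all_order all_algebra.
From mathcomp Require Import all_classical all_reals all_analysis.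

Set Implicit Arguments.
Unset Strict Implicit.
Unset Printing Implicit Defensive.

Import Order.TTheory GRing.Theory Num.Theory.
Import numFieldNormedType.Exports.

Local Open Scope classical_set_scope.
Local Open Scope ring_scope.

Section dea.
Context {R : realType}.
Variables (m s n q : nat).
Variables (x : 'M[R]_(m, n)) (y : 'M[R]_(s, n)) (o : 'I_n).
Variable z : 'I_q -> 'I_m + 'I_s.

(* [b c] tells whether the candidate [z c] is selected. *)
Definition scenario := {ffun 'I_q -> bool}.

Implicit Types (b : scenario) (v : 'I_m + 'I_s).

(* [inl i] is the i-th input and [inr r] the r-th output.  A variable that is
   not a candidate is present in every scenario; when [z] is onto, the variables
   of the model are exactly the selected candidates. *)
Definition included b v : bool := [forall c, (z c == v) ==> b c].

Definition dea_feasible b (theta : R) (lambda : 'I_n -> R) : Prop :=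
  [/\ forall i : 'I_m, included b (inl i) ->
        \sum_(j < n) lambda j * x i j <= theta * x i o,
      forall r : 'I_s, included b (inr r) ->
        \sum_(j < n) lambda j * y r j >= y r o
    & forall j, 0 <= lambda j].

(* The program is always feasible ([theta = 1], [lambda] the indicator of [o]),
   and it is bounded below as soon as [x i o > 0] for some included input [i].
   Otherwise the real [inf] of the library takes the value 0, which is also the
   optimal value under the additional constraint [0 <= theta]. *)
Definition dea_score b : R :=
  if b == [ffun=> false] then 1
  else inf [set theta | exists lambda, dea_feasible b theta lambda].

End dea.

(* Lebesgue measure on R^n; [lebesgue_tuple_box] characterizes it. *)
Section lebesgue_tuple.
Context {R : realType}.
Local Notation RR := (measurableTypeR R).
Local Notation mu1 := (@lebesgue_measure R).

Definition cons_tuple n (p : RR * n.-tuple RR) : n.+1.-tuple RR :=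
  [tuple of p.1 :: p.2].

Lemma measurable_cons_tuple n :
  measurable_fun [set: RR * n.-tuple RR] (@cons_tuple n).
Proof. exact: measurable_cons. Qed.

Section step.
Variables (n : nat) (mu : {sigma_finite_measure set (n.-tuple RR) -> \bar R}).

Definition lebesgue_cons : set (n.+1.-tuple RR) -> \bar R :=
  pushforward (mu1 \x mu)%E (@cons_tuple n).

Let mcons := @measurable_cons_tuple n.

Let lebesgue_cons0 : lebesgue_cons set0 = 0%E.
Proof. by rewrite /lebesgue_cons /pushforward preimage_set0 measure0. Qed.

Let lebesgue_cons_ge0 A : (0 <= lebesgue_cons A)%E.
Proof. by rewrite /lebesgue_cons /pushforward measure_ge0. Qed.

Let lebesgue_cons_sigma_additive : semi_sigma_additive lebesgue_cons.
Proof.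
move=> F mF tF mUF; rewrite /lebesgue_cons /pushforward preimage_bigcup.
apply: measure_semi_sigma_additive.
- by move=> k; rewrite -[X in measurable X]setTI; exact: mcons.
- apply/trivIsetP => /= i j _ _ ij; rewrite -preimage_setI.
  by move/trivIsetP : tF => /(_ _ _ _ _ ij) ->//; rewrite preimage_set0.
- by rewrite -preimage_bigcup -[X in measurable X]setTI; exact: mcons.
Qed.

HB.instance Definition _ := isMeasure.Build _ _ _ lebesgue_cons
  lebesgue_cons0 lebesgue_cons_ge0 lebesgue_cons_sigma_additive.

Let sigma_finite_lebesgue_cons : sigma_finite setT lebesgue_cons.
Proof.
have /sigma_finiteP[F [TF ndF Foo]] := sigma_finiteT mu1.
have /sigma_finiteP[G [TG ndG Goo]] := sigma_finiteT mu.
pose u (t : n.+1.-tuple RR) : RR * n.-tuple RR :=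
  (tnth t ord0, [tuple of behead t]).
have mu_u : measurable_fun [set: n.+1.-tuple RR] u.
  apply/measurable_fun_pair; first exact: measurable_tnth.
  exact: measurable_behead.
exists (fun k => u @^-1` (F k `*` G k)).
  rewrite -preimage_bigcup (_ : \bigcup_k _ = setT) ?preimage_setT//.
  apply/seteqP; split=> // -[a t] _.
  have [i _ Fia] : (\bigcup_i F i) a by rewrite -TF.
  have [j _ Gjt] : (\bigcup_i G i) t by rewrite -TG.
  exists (maxn i j) => //; split => /=.
  - by move: a Fia; exact/subsetPset/ndF/leq_maxl.
  - by move: t Gjt; exact/subsetPset/ndG/leq_maxr.
move=> k; have [mF Fk] := Foo k; have [mG Gk] := Goo k; split.
  by rewrite -[X in measurable X]setTI; apply: mu_u => //; exact: measurableX.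
rewrite /lebesgue_cons /pushforward -comp_preimage (_ : u \o _ = id).
  by rewrite /= product_measure1E// lte_mul_pinfty// ge0_fin_numE.
by rewrite funeqE => -[a t] /=; congr pair; apply/val_inj.
Qed.

HB.instance Definition _ := Measure_isSigmaFinite.Build _ _ _ lebesgue_cons
  sigma_finite_lebesgue_cons.

End step.

Fixpoint lebesgue_tuple n : {sigma_finite_measure set (n.-tuple RR) -> \bar R} :=
  match n with
  | 0 => \d_([tuple] : 0.-tuple RR)
  | n'.+1 => lebesgue_cons (lebesgue_tuple n')
  end.

Lemma lebesgue_tuple_box n (A : 'I_n -> set RR) :
  (forall i, measurable (A i)) ->
  lebesgue_tuple n [set p | forall i, A i (tnth p i)] =
  (\prod_(i < n) mu1 (A i))%E.
Proof.
elim: n A => [|n IHn] A mA.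
  by rewrite big_ord0 /= diracE mem_set// => -[].
rewrite big_ord_recl -IHn; last by move=> i; exact: mA.
rewrite [LHS]/= /lebesgue_cons /pushforward -product_measure1E//; last first.
  rewrite (_ : mkset _ = \bigcap_(i in [set: 'I_n])
      (fun p : n.-tuple RR => tnth p i) @^-1` A (lift ord0 i)); last first.
    by apply/seteqP; split=> p Ap i; [move=> _|]; exact: Ap.
  apply: fin_bigcap_measurable => // i _.
  by rewrite -[X in measurable X]setTI; exact: measurable_tnth.
congr ((_ \x _)%E _); apply/seteqP; split=> -[a p] /=.
  move=> Ap; split=> [|i]; first exact: (Ap ord0).
  by have := Ap (lift ord0 i); rewrite /cons_tuple tnthS.
move=> [Aa Ap] i; have [->//|] := eqVneq i ord0; rewrite eq_sym.
by move=> /unlift_some[j -> _]; rewrite /cons_tuple tnthS.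
Qed.

End lebesgue_tuple.

Section probability.
Context {R : realType}.

(* [g] is a density of the law of [X] with respect to [mu]. *)
Definition has_density d d' (T : measurableType d) (T' : measurableType d')
    (P : probability T R) (mu : set T' -> \bar R) (X : T -> T') (g : T' -> R) :=
  [/\ measurable_fun [set: T'] g,
      forall t, 0 <= g t
    & forall A, measurable A -> P (X @^-1` A) = (\int[mu]_(t in A) (g t)%:E)%E].

Definition mutually_independent d (T : measurableType d) (P : probability T R)
    (q : nat) (X : 'I_q -> {RV P >-> R}) :=
  forall (J : {set 'I_q}) (A : 'I_q -> set R), (forall c, measurable (A c)) ->
    P (\bigcap_(c in [set` J]) (X c @^-1` A c)) =
    (\prod_(c in J) P (X c @^-1` A c))%E.

Definition Gamma (a : R) : R :=
  \int[lebesgue_measure]_(t in `]0, +oo[) (t `^ (a - 1) * expR (- t)).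

Definition beta_density (alpha gamma : R) : R -> R :=
  (fun t => Gamma (alpha + gamma) / (Gamma alpha * Gamma gamma)
            * t `^ (alpha - 1) * (1 - t) `^ (gamma - 1)) \_ `[0, 1].

End probability.

Section unconditional_score.
Context {R : realType}.
Variable q : nat.
Implicit Types (b : scenario q) (p : q.-tuple R) (f : q.-tuple R -> R).

(* P(Theta_0 = theta_0^b | P = p) *)
Definition conditional_prob p b : R :=
  \prod_(c < q) (tnth p c ^+ b c * (1 - tnth p c) ^+ (1 - b c)).

Definition unit_cube : set (q.-tuple R) :=
  [set p | forall c, 0 <= tnth p c <= 1].

(* P(Theta_0 = theta_0^b), for a vector of selection probabilities with joint
   density [f] *)
Definition unconditional_prob f b : R :=
  \int[lebesgue_tuple q]_(p in unit_cube) (conditional_prob p b * f p).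

Definition expected_score f (theta : scenario q -> R) : R :=
  \sum_b theta b * unconditional_prob f b.

End unconditional_score.

(* Main.v *)
Require Import Defs.
From HB Require Import structures.
From mathcomp Require Import all_boot all_order all_algebra.
From mathcomp Require Import all_classical all_reals all_analysis.
From mathcomp Require Import measurable_realfun ring lra.

Set Implicit Arguments.
Unset Strict Implicit.
Unset Printing Implicit Defensive.

Import Order.TTheory GRing.Theory Num.Theory.
Import numFieldNormedType.Exports.

Local Open Scope classical_set_scope.
Local Open Scope ring_scope.

(** The expected score is the sum of the numbers [dea_score x y o z b] with the
    weights [unconditional_prob f b], and the two sides are equal because these
    weights are, scenario by scenario, the coefficients of the right-hand side.

    The conditional probability of a scenario is, on the unit cube, a product of
    one factor per candidate, [t] if the candidate is selected and [1 - t]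
    otherwise ([selection_factor]).  Read through the law of [P], the weight of
    [b] is therefore the expectation of a product of functions of the
    independent variables [P c], hence the product of their expectations
    ([unconditional_prob_prod]), and each of these is the mean of [P c] or of
    [1 - P c] ([beta_moment]).  Going through the law of [P] rather than through
    the density [f] avoids identifying [f] almost everywhere with the product of
    the beta densities.

    The mean of a beta variable is found without evaluating any Gamma function.
    Call [m1] and [m2] the integrals of [t] and of [1 - t] against the density.
    Their sum is [1] because the density is that of a probability.  Moreover,
    [(alpha * (1 - t) - gamma * t)] times the density is the derivative of a
    multiple of [t `^ alpha * (1 - t) `^ gamma], which vanishes at [0] and [1],
    so that [alpha * m2 = gamma * m1] ([integral_dbeta_primitive]).  These two
    linear equations give [m1 = alpha / (alpha + gamma)].

    Both changes of variable and the product formula for independent variables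
    rest on one principle, [eq_integral_transfer]: two integrals that agree on
    indicator functions agree on all nonnegative measurable functions. *)

(** * From indicator functions to nonnegative functions *)

Section transfer.
Context {R : realType}.
Local Open Scope ereal_scope.
Import HBNNSimple.

(** The right-hand side depends on [mu], [Y] and [h] only through the set
    function [A |-> \int[mu]_(x in Y @^-1` A) h x].  It is obtained by monotone
    convergence along the canonical simple approximations of [g].  The function
    [g] is real-valued so that the products also converge where [h] is
    infinite. *)
Lemma ge0_integral_comp_limn d d' (T : measurableType d)
    (T' : measurableType d') (mu : {measure set T -> \bar R}) (Y : T -> T')
    (h : T -> \bar R) (g : T' -> R)
    (mg : measurable_fun [set: T'] (EFin \o g)) :
  measurable_fun [set: T] Y ->
  measurable_fun [set: T] h -> (forall x, 0 <= h x) ->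
  (forall y, (0 <= g y)%R) ->
  \int[mu]_x ((g (Y x))%:E * h x) =
  limn (fun n => let s := nnsfun_approx measurableT mg n in
    \sum_(r \in range s)
      (r%:E * \int[mu]_(x in Y @^-1` (s @^-1` [set r])) h x)).
Proof.
move=> mY mh h0 g0.
pose s := nnsfun_approx measurableT mg.
have mYs n r : measurable (Y @^-1` (s n @^-1` [set r])).
  by rewrite -[X in measurable X]setTI; exact: mY.
transitivity (limn (fun n => \int[mu]_x ((s n (Y x))%:E * h x))).
  rewrite -monotone_convergence//.
  - apply: eq_integral => x _; apply/esym/cvg_lim => //.
    have cs : (s n (Y x))%:E @[n --> \oo] --> (g (Y x))%:E.
      by apply: cvg_nnsfun_approx => // y _; rewrite lee_fin.
    (* if [g (Y x) = 0], the product with an infinite [h x] is not continuous,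
       but the approximations vanish too *)
    have [gx0|gx0] := eqVneq (g (Y x)) 0%R; last first.
      apply: cvgeM => //; last exact: cvg_cst.
      by rewrite /mule_def gx0; case: (h x).
    rewrite gx0 mul0e; apply: cvg_near_cst; near=> n.
    suff -> : s n (Y x) = 0%R by rewrite mul0e.
    apply/eqP; rewrite eq_le fun_ge0 andbT -lee_fin -gx0 /s nnsfun_approxE.
    by apply: le_approx => // y _; rewrite lee_fin.
  - move=> n; apply: emeasurable_funM => //.
    apply/measurable_EFinP; exact: (measurableT_comp _ mY).
  - by move=> n x _; rewrite mule_ge0// lee_fin.
  - move=> x _ m n mn; rewrite lee_wpmul2r// lee_fin.
    exact/lefP/nd_nnsfun_approx.
congr (limn _); apply/funext => n /=.
under eq_integral.
  move=> x _; rewrite fimfunE -fsumEFin// ge0_mule_fsuml; last first.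
    by move=> r; rewrite EFinM nnfun_muleindic_ge0.
  over.
rewrite ge0_integral_fsum//; last 2 first.
- move=> r; apply: emeasurable_funM => //.
  apply/measurable_EFinP/measurable_funM => //.
  exact: (measurableT_comp _ mY).
- by move=> r x _; rewrite mule_ge0// EFinM nnfun_muleindic_ge0.
apply: eq_fsbigr => r /[!inE] -[y _ syr].
have r0 : (0 <= r)%R by rewrite -syr.
under eq_integral do rewrite EFinM -muleA.
rewrite ge0_integralZl_EFin//; last 2 first.
- by move=> x _; rewrite mule_ge0// lee_fin.
- apply: emeasurable_funM => //; apply/measurable_EFinP.
  exact: (measurableT_comp _ mY).
congr (_ * _); rewrite [RHS]integral_mkcond; apply: eq_integral => x _.
by rewrite epatch_indic muleC.
Unshelve. all: by end_near. Qed.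

(** Instances: [Y1] a random variable and [h2] its density, or [h1] a function
    independent of [Y1] and [h2] the constant [E[h1]]. *)
Lemma eq_integral_transfer d1 d2 d' (T1 : measurableType d1)
    (T2 : measurableType d2) (T' : measurableType d')
    (mu1 : {measure set T1 -> \bar R}) (mu2 : {measure set T2 -> \bar R})
    (Y1 : T1 -> T') (Y2 : T2 -> T') (h1 : T1 -> \bar R) (h2 : T2 -> \bar R)
    (g : T' -> R) :
  measurable_fun [set: T1] Y1 -> measurable_fun [set: T2] Y2 ->
  measurable_fun [set: T1] h1 -> measurable_fun [set: T2] h2 ->
  (forall x, 0 <= h1 x) -> (forall x, 0 <= h2 x) ->
  (forall A, measurable A ->
    \int[mu1]_(x in Y1 @^-1` A) h1 x = \int[mu2]_(x in Y2 @^-1` A) h2 x) ->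
  measurable_fun [set: T'] g -> (forall y, (0 <= g y)%R) ->
  \int[mu1]_x ((g (Y1 x))%:E * h1 x) = \int[mu2]_x ((g (Y2 x))%:E * h2 x).
Proof.
move=> mY1 mY2 mh1 mh2 h10 h20 H mg g0.
have mEg : measurable_fun [set: T'] (EFin \o g) by exact/measurable_EFinP.
rewrite (ge0_integral_comp_limn _ mEg)// (ge0_integral_comp_limn _ mEg)//.
congr (limn _); apply/funext => n /=; apply: eq_fsbigr => r _.
by rewrite H.
Qed.

Lemma integral_density d d' (T : measurableType d) (T' : measurableType d')
    (P : probability T R) (mu : {measure set T' -> \bar R}) (X : T -> T')
    (f : T' -> R) (g : T' -> R) :
  measurable_fun [set: T] X -> has_density P mu X f ->
  measurable_fun [set: T'] g -> (forall y, (0 <= g y)%R) ->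
  \int[P]_w (g (X w))%:E = \int[mu]_t (g t * f t)%:E.
Proof.
move=> mX [mf f0 Pf] mg g0.
under [RHS]eq_integral do rewrite EFinM.
rewrite -(@eq_integral_transfer _ _ _ T _ _ P mu X id (cst 1) (EFin \o f))//.
- by apply: eq_integral => w _; rewrite mule1.
- exact/measurable_EFinP.
- move=> A mA; rewrite -Pf// integral_cst ?mul1e//.
  by rewrite -[X in measurable X]setTI; exact: mX.
Qed.
End transfer.

(** * The mean of a beta distribution *)

(** The boundary terms of the integration over `[e, 1 - e] tend to 0. *)
Lemma cvg_powR_onem {R : realType} (p r : R) (e : R^nat) : 0 < p -> 0 < r ->
  (forall n, 0 < e n < 1) -> e n @[n --> \oo] --> 0 ->
  e n `^ p * (1 - e n) `^ r @[n --> \oo] --> 0.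
Proof.
move=> p0 r0 e01 e0.
have ep : e n `^ p @[n --> \oo] --> 0.
  have /cvg_at_rightP := powR_cvg0 p0; apply; split=> // n.
  by have /andP[] := e01 n.
apply: (@squeeze_cvgr _ _ _ _ (cst 0) (fun n => e n `^ p)) => //;
  last exact: cvg_cst.
apply: nearW => n; have /andP[en0 en1] := e01 n.
rewrite mulr_ge0 ?powR_ge0//= ler_piMr ?powR_ge0//.
have := @ge0_ler_powR R r (ltW r0) (1 - e n) 1.
rewrite powR1; apply; rewrite ?nnegrE ?subr_ge0 ?(ltW en1)//.
by rewrite lerBlDr lerDl ltW.
Qed.

Section beta.
Context {R : realType}.
Local Notation mu := (@lebesgue_measure R).
Variables (K a g : R) (a0 : 0 < a) (g0 : 0 < g).

(** The beta density on the unit interval, with an arbitrary constant in place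
    of its normalization. *)
Definition beta_wt (t : R) := K * t `^ (a - 1) * (1 - t) `^ (g - 1).

Definition beta_primitive (t : R) := K * (t `^ a * (1 - t) `^ g).

Definition dbeta_primitive t := (a * (1 - t) - g * t) * beta_wt t.

Lemma is_derive_beta_primitive (t : R) : 0 < t < 1 ->
  is_derive t 1 beta_primitive (dbeta_primitive t).
Proof.
move=> /andP[t0 t1].
have t1' : 0 < 1 - t by rewrite subr_gt0.
have d1 := is_derive1_powR a t0.
have d2 := is_derive1_powR g t1'.
have d3 : is_derive t (1:R) (fun u : R => 1 - u) (-1).
  by apply: is_derive_eq; rewrite add0r mul1r.
have d4 : is_derive t (1:R) (fun u : R => (1 - u) `^ g)
    (g * (1 - t) `^ (g - 1) * -1).
  have := @is_derive1_comp R (@powR R ^~ g) (fun u : R => 1 - u) t _ _ d2 d3.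
  exact.
have d5 := @is_deriveM R R (@powR R ^~ a) _ t 1 _ _ d1 d4.
have d6 := is_deriveZ K d5.
apply: (is_derive_eq d6) => /=.
have e1 : t `^ a = t * t `^ (a - 1).
  by rewrite mulr_powRB1 ?ltW.
have e2 : (1 - t) `^ g = (1 - t) * (1 - t) `^ (g - 1).
  by rewrite mulr_powRB1 ?ltW.
rewrite /dbeta_primitive /beta_wt /GRing.scale/= e1 e2; ring.
Qed.

Lemma continuous_beta_wt (t : R) : 0 < t < 1 -> {for t, continuous beta_wt}.
Proof.
move=> /andP[t0 t1].
have t1' : 0 < 1 - t by rewrite subr_gt0.
apply: differentiable_continuous; apply/derivable1_diffP.
have d1 := is_derive1_powR (a - 1) t0.
have d2 := is_derive1_powR (g - 1) t1'.
have d3 : is_derive t (1:R) (fun u : R => 1 - u) (-1).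
  by apply: is_derive_eq; rewrite add0r mul1r.
have d4 :=
  @is_derive1_comp R (@powR R ^~ (g - 1)) (fun u : R => 1 - u) t _ _ d2 d3.
have d5 := @is_deriveM R R _ _ t 1 _ _ (is_deriveZ K d1) d4.
exact: (@ex_derive _ _ _ _ _ _ _ d5).
Qed.

Lemma measurable_beta_wt D : measurable_fun D beta_wt.
Proof.
apply: measurable_funTS.
apply: measurable_funM.
  by apply: measurable_funM => //; exact: measurable_powR.
apply: (measurableT_comp (measurable_powR _)).
exact: measurable_funB.
Qed.

Lemma integral_dbeta_primitive_itv (e : R) : 0 < e < 2^-1 ->
  (\int[mu]_(t in `[e, (1 - e)%R]) (dbeta_primitive t)%:E =
   (beta_primitive (1 - e) - beta_primitive e)%:E)%E.
Proof.
move=> /andP[e0 e1].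
have e2 : e < 1 - e by lra.
have in01 t : t \in `[e, 1 - e] -> 0 < t < 1.
  by rewrite in_itv/= => /andP[]; lra.
have D t : t \in `[e, 1 - e] ->
    is_derive t 1 beta_primitive (dbeta_primitive t).
  by move=> /in01; exact: is_derive_beta_primitive.
rewrite (continuous_FTC2 e2 (F := beta_primitive)).
- by rewrite EFinB.
- apply: continuous_in_subspaceT => t /set_mem/= /in01 t01.
  apply: cvgM; last exact: continuous_beta_wt.
  apply: cvgB; last by apply: cvgZr.
  by apply: cvgZr; apply: cvgB => //; exact: cvg_cst.
- have C t : t \in `[e, 1 - e] -> {for t, continuous beta_primitive}.
    move=> /D h; apply: differentiable_continuous; apply/derivable1_diffP.
    exact: (@ex_derive _ _ _ _ _ _ _ h).
  split.
  + move=> t /subset_itv_oo_cc /D h; exact: (@ex_derive _ _ _ _ _ _ _ h).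
  + by apply: cvg_at_right_filter; apply: C; rewrite in_itv/= lexx ltW.
  + by apply: cvg_at_left_filter; apply: C; rewrite in_itv/= lexx ltW.
- by move=> t /subset_itv_oo_cc /D h; rewrite derive1E;
    exact: (@derive_val _ _ _ _ _ _ _ h).
Qed.

Lemma measurable_dbeta_primitive D :
  measurable_fun D (fun t => (dbeta_primitive t)%:E).
Proof.
apply: measurable_funTS; apply/measurable_EFinP.
apply: measurable_funM; last exact: measurable_beta_wt.
by apply: measurable_funB; apply: measurable_funM => //; exact: measurable_funB.
Qed.

Hypothesis iwt : mu.-integrable setT (EFin \o (beta_wt \_ `[0, 1])).

(** The derivative is unbounded near an endpoint when the exponent there is less
    than 1, so the fundamental theorem of calculus is applied on `[e, 1 - e]
    and [e] tends to 0; the derivative is dominated by a multiple of [beta_wt],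
    which is integrable. *)
Lemma integral_dbeta_primitive :
  (\int[mu]_(t in `]0%R, 1%R[) (dbeta_primitive t)%:E = 0)%E.
Proof.
pose e n : R := n.+3%:R^-1.
have e0 n : 0 < e n < 2^-1.
  by rewrite /e invr_gt0 ltr0n/= ltf_pV2 ?posrE ?ltr0n// ltr_nat//.
have cve : e n @[n --> \oo] --> 0.
  have := @cvg_harmonic R; rewrite -(cvg_shiftn 2).
  by under eq_fun do rewrite /= /harmonic addn2.
have e1 n : 0 < e n < 1.
  by have /andP[e0n en] := e0 n; rewrite e0n (lt_trans en)// invf_lt1 ?ltr1n.
pose f_ n := (fun t => (dbeta_primitive t)%:E) \_ `[e n, 1 - e n].
have iswt : mu.-integrable `]0, 1[ (fun t => (dbeta_primitive t)%:E).
  have : mu.-integrable `]0, 1[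
      (fun t => ((a + g) * (beta_wt \_ `[0, 1]) t)%:E).
    apply: (@integrableS _ _ _ mu setT) => //.
    by have := integrableZl measurableT (a + g) iwt.
  apply: le_integrable => //; first exact: measurable_dbeta_primitive.
  move=> t /= t01; rewrite lee_fin patchE mem_set; last first.
    exact: subset_itv_oo_cc t01.
  rewrite !normrM ler_wpM2r// [leRHS]ger0_norm ?addr_ge0 ?(ltW a0) ?(ltW g0)//.
  move: t01; rewrite in_itv/= => /andP[t0 t1].
  rewrite (le_trans (ler_normB _ _))// !normrM !gtr0_norm ?subr_gt0//.
  by rewrite lerD// ler_piMr ?(ltW a0) ?(ltW g0) ?(ltW t1)// lerBlDr lerDl ltW.
have [] := @dominated_convergence _ _ _ mu `]0%R, 1%R[%classic
  (measurable_itv _) f_ (fun t => (dbeta_primitive t)%:E)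
  (fun t => `|dbeta_primitive t|%:E).
- move=> n; apply: measurable_funTS.
  apply/(measurable_restrictT _ _).1 => //; exact: measurable_dbeta_primitive.
- exact: measurable_dbeta_primitive.
- apply/aeW => t /= /[!in_itv]/= /andP[t0 t1].
  have tm : 0 < Num.min t (1 - t) by rewrite lt_min t0 subr_gt0.
  apply: cvg_near_cst; near=> n; rewrite /f_ patchE mem_set// /= in_itv/=.
  have [te t1e] : e n < t /\ e n < 1 - t.
    apply/andP; rewrite -lt_min; near: n.
    by apply: cvgr_lt cve _ tm.
  by rewrite ltW//= lerBrDl -lerBrDr ltW.
- exact: integrable_abse iswt.
- apply/aeW => t n _; rewrite /f_ patchE; case: ifPn => //= _.
  by rewrite normr0 lee_fin.
move=> _ _ h.
suff : [sequence (\int[mu]_(x in `]0%R, 1%R[) f_ n x)%E]_n @ \oo --> 0%E.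
  by move=> h0; exact: (cvg_unique _ h h0).
rewrite (_ : [sequence _]_n = fun n =>
  (beta_primitive (1 - e n) - beta_primitive (e n))%:E).
  apply/cvg_EFin; first exact: nearW.
  rewrite [X in X @ _ --> _](_ : _ = fun n =>
      K * (e n `^ g * (1 - e n) `^ a) - K * (e n `^ a * (1 - e n) `^ g));
    last first.
    apply/funext => n.
    by rewrite /= /beta_primitive subKr [X in K * X - _]mulrC.
  rewrite -[X in _ --> X](subrr (K * 0)).
  by apply: cvgB; apply: cvgZr; exact: cvg_powR_onem.
apply/funext => n /=.
rewrite -integral_dbeta_primitive_itv// /f_ -integral_mkcondr.
congr integral; apply/setIidPr => t /=; rewrite !in_itv/= => /andP[].
by have /andP[] := e0 n; move=> *; apply/andP; lra.
Unshelve. all: by end_near. Qed.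
End beta.

(** Truncated to the unit interval: this makes it nonnegative everywhere, and
    the product over the candidates then restricts the integral to the unit
    cube. *)
Definition selection_factor {R : realType} (b : bool) : R -> R :=
  (fun t : R => t ^+ b * (1 - t) ^+ (1 - b)) \_ `[0, 1].

Lemma selection_factor_ge0 {R : realType} b (t : R) : 0 <= selection_factor b t.
Proof.
rewrite /selection_factor patchE; case: ifPn => // /set_mem/=.
by rewrite in_itv/= => /andP[t0 t1]; rewrite mulr_ge0 ?exprn_ge0 ?subr_ge0.
Qed.

Lemma measurable_selection_factor {R : realType} b :
  measurable_fun [set: R] (selection_factor b).
Proof.
apply/(measurable_restrictT _ _).1 => //; apply: measurable_funTS.
apply: measurable_funM; first exact: measurable_funX.
by apply: measurable_funX; exact: measurable_funB.
Qed.

(** With [m1] and [m2] the means of [X] and [1 - X], [m1 + m2 = 1] is the total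
    mass of the density, and [a * m2 = g * m1] is integration by parts. *)
Lemma beta_moment {R : realType} d (T : measurableType d) (P : probability T R)
    (X : {RV P >-> R}) (a g : R) (b : bool) : 0 < a -> 0 < g ->
  has_density P lebesgue_measure X (beta_density a g) ->
  (\int[P]_w (selection_factor b (X w))%:E =
   (a ^+ b * g ^+ (1 - b) / (a + g))%:E)%E.
Proof.
move=> a0 g0 dX; have [mbeta beta0 PX] := dX.
set beta := beta_density a g in dX mbeta beta0 PX.
pose mu := @lebesgue_measure R.
have ibeta1 : (\int[mu]_t (beta t)%:E = 1)%E.
  by rewrite -PX// preimage_setT probability_setT.
pose F c t := selection_factor c t * beta t.
have mF c : measurable_fun setT (F c).
  by apply: measurable_funM => //; exact: measurable_selection_factor.
have mEF c : measurable_fun setT (fun t => (F c t)%:E).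
  by apply/measurable_EFinP; exact: mF.
have F0 c t : 0 <= F c t by rewrite mulr_ge0// selection_factor_ge0.
pose I c := (\int[mu]_t (F c t)%:E)%E.
have PI c : (\int[P]_w (selection_factor c (X w))%:E = I c)%E.
  rewrite (integral_density (mu := mu) _ dX)//.
  - exact: (@measurable_funPT _ _ _ _ X).
  - exact: measurable_selection_factor.
  - exact: selection_factor_ge0.
have F1 t : F true t + F false t = beta t.
  rewrite /F -mulrDl /selection_factor /beta /beta_density !patchE.
  case: ifPn => _; last by rewrite addr0 mulr0.
  by rewrite /= subnn subn0 !expr1 !expr0; ring.
have I1 : (I true + I false = 1)%E.
  rewrite -ge0_integralD//=; last 4 first.
  - by move=> t _; rewrite lee_fin.
  - exact: mEF.
  - by move=> t _; rewrite lee_fin.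
  - exact: mEF.
  by rewrite -ibeta1; apply: eq_integral => t _; rewrite -EFinD F1.
have Ifin c : I c \is a fin_num.
  have : (I true + I false)%E \is a fin_num by rewrite I1.
  by rewrite fin_numD => /andP[]; case: c.
have iF c : mu.-integrable setT (EFin \o F c).
  apply/integrableP; split; first exact: mEF.
  under eq_integral do rewrite /= ger0_norm//.
  by rewrite -/(I c) ltey_eq Ifin.
have ibeta : mu.-integrable setT (EFin \o beta).
  apply/integrableP; split; first exact/measurable_EFinP.
  under eq_integral do rewrite /= ger0_norm//.
  by rewrite ibeta1 ltry.
have I2 : (a%:E * I false - g%:E * I true = 0)%E.
  rewrite /I -!integralZl//; [|exact: iF..].
  have iZ r c := integrableZl measurableT r (iF c).
  rewrite -[LHS](integralB measurableT (iZ a false) (iZ g true)).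
  rewrite -[RHS](integral_dbeta_primitive a0 g0 ibeta).
  rewrite -(@integral_itv_bndoo _ _ _ _ true false);
    last exact: measurable_dbeta_primitive.
  rewrite [RHS]integral_mkcond; apply: eq_integral => t _.
  rewrite /= /F /selection_factor /beta /beta_density.
  rewrite /dbeta_primitive /beta_wt !patchE.
  case: ifPn => _; last first.
    by rewrite !mul0r -!EFinM !mulr0 -EFinB subr0.
  rewrite -!EFinM -EFinB; congr EFin.
  by rewrite /= subnn subn0 !expr1 !expr0; ring.
rewrite PI; move: I1 I2 (Ifin true) (Ifin false).
have ag : a + g != 0 by rewrite gt_eqF// addr_gt0.
case: b; case: (I true) => // m1; case: (I false) => // m2.
all: rewrite -!EFinM -EFinB => -[e1] [e2] _ _; congr EFin.
all: apply: (mulIf ag); rewrite divfK//=.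
all: rewrite ?subnn ?subn0 ?expr1 ?expr0 ?mulr1 ?mul1r.
- by rewrite mulrDr [m1 * g]mulrC -(subr0_eq e2) -[RHS]mulr1 -e1; ring.
- by rewrite mulrDr [m2 * a]mulrC (subr0_eq e2) -[RHS]mulr1 -e1; ring.
Qed.

(** * Independence and the weight of a scenario *)

(** Independence is the case where every [g c] is an indicator function.  The
    indicators are replaced one at a time by arbitrary functions: when all but
    the [i]-th function are fixed, both sides are integrals of [g i] that agree
    on indicators. *)
Lemma integral_prod_independent {R : realType} d (T : measurableType d)
    (P : probability T R) (q : nat) (X : 'I_q -> {RV P >-> R})
    (g : 'I_q -> R -> R) :
  mutually_independent X ->
  (forall c, measurable_fun [set: R] (g c)) -> (forall c t, 0 <= g c t) ->
  (\int[P]_w (\prod_(c < q) g c (X c w))%:E =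
   \prod_(c < q) \int[P]_w (g c (X c w))%:E)%E.
Proof.
move=> indX mg g0.
have mX c : measurable_fun [set: T] (X c).
  exact: (@measurable_funPT _ _ _ _ (X c)).
(* the functions of index at least [k] are still indicators *)
suff H k : forall g : 'I_q -> R -> R,
    (forall c, measurable_fun [set: R] (g c)) -> (forall c t, 0 <= g c t) ->
    (forall c : 'I_q, (k <= c)%N -> exists2 A, measurable A & g c = \1_A) ->
    (\int[P]_w (\prod_(c < q) g c (X c w))%:E =
     \prod_(c < q) \int[P]_w (g c (X c w))%:E)%E.
  by apply: (H q) => // c; rewrite leqNgt ltn_ord.
elim: k => [|k IHk] {mg g0}g mg g0 gA.
  have {gA}/choice[A gA] : forall c, exists A, measurable A /\ g c = \1_A.
    by move=> c; have [A mA gE] := gA c isT; exists A.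
  have mA c : measurable (A c) by have [] := gA c.
  have mXA c : measurable (X c @^-1` A c).
    by rewrite -[X in measurable X]setTI; exact: mX.
  pose B := \bigcap_(c in [set` [set: 'I_q]%SET]) (X c @^-1` A c).
  have gE c w : g c (X c w) = \1_(X c @^-1` A c) w by have [_ ->] := gA c.
  transitivity (\int[P]_w (\1_B w)%:E)%E.
    apply: eq_integral => w _; congr EFin; under eq_bigr do rewrite gE indicE.
    rewrite indicE; case: (boolP (w \in B)) => [/set_mem Bw|nBw].
      by rewrite big1// => c _; rewrite mem_set//; apply: Bw; rewrite /= inE.
    have [c nA] : exists c, ~ (X c @^-1` A c) w.
      apply/existsNP => Aw; move/negP: nBw; apply.
      by apply/mem_set => c _; exact: Aw.
    by rewrite (bigD1 c)//= memNset// mul0r.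
  rewrite integral_indic//; last by apply: fin_bigcap_measurable.
  rewrite setIT [LHS](indX [set: _]%SET A mA).
  apply: eq_big => [c|c _]; first by rewrite inE.
  under eq_integral do rewrite gE.
  by rewrite integral_indic// setIT.
have [qk|kq] := leqP q k.
  by apply: IHk => // c kc; have := leq_trans (ltn_ord c) qk; rewrite ltnNge kc.
pose i := Ordinal kq.
pose h w := \prod_(c < q | c != i) g c (X c w).
have h0 w : 0 <= h w by apply: prodr_ge0 => c _.
have mh : measurable_fun [set: T] h.
  rewrite /h; under eq_fun do rewrite -big_filter.
  by apply: measurable_prod => c _; exact: (measurableT_comp (mg c) (mX c)).
pose C := (\prod_(c < q | c != i) \int[P]_w (g c (X c w))%:E)%E.
have C0 : (0 <= C)%E.
  by apply: prode_ge0 => c _; apply: integral_ge0 => w _; rewrite lee_fin.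
rewrite [RHS](bigD1 i)//= -/C.
transitivity (\int[P]_w ((g i (X i w))%:E * (h w)%:E))%E.
  by apply: eq_integral => w _; rewrite (bigD1 i)//= EFinM.
rewrite -ge0_integralZr//; last 2 first.
- by apply/measurable_EFinP; exact: (measurableT_comp (mg i) (mX i)).
- by move=> w _; rewrite lee_fin.
apply: (@eq_integral_transfer R _ _ _ T T R P P (X i) (X i)
  (EFin \o h) (cst C) (g i)) => //.
- exact/measurable_EFinP.
move=> A mA.
pose g' c := if c == i then \1_A else g c.
have g'i : g' i = \1_A by rewrite /g' eqxx.
have g'c c : c != i -> g' c = g c by rewrite /g' => /negbTE ->.
have mXA : measurable (X i @^-1` A).
  by rewrite -[Y in measurable Y]setTI; exact: mX.
have {}IHk := IHk g'.
rewrite integral_cst//= muleC.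
have -> : P (X i @^-1` A) = (\int[P]_w (g' i (X i w))%:E)%E.
  by rewrite g'i -[LHS](congr1 P (setIT _)) -integral_indic//.
transitivity (\int[P]_w (\prod_(c < q) g' c (X c w))%:E)%E.
  rewrite integral_mkcond; apply: eq_integral => w _.
  rewrite epatch_indic /= (bigD1 i)//= g'i EFinM muleC; congr (_ * (_)%:E)%E.
  by apply: eq_bigr => c /g'c ->.
rewrite IHk.
- by rewrite (bigD1 i)//=; congr (_ * _)%E; apply: eq_bigr => c /g'c ->.
- move=> c; have [->|/g'c->//] := eqVneq c i; rewrite g'i.
  exact: measurable_indic.
- by move=> c t; have [->|/g'c->//] := eqVneq c i; rewrite g'i.
- move=> c; rewrite leq_eqVlt => /predU1P[kc|kc].
    by exists A => //; rewrite -g'i; congr g'; apply/val_inj.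
  by rewrite g'c; [exact: gA|rewrite -val_eqE/= gtn_eqF].
Qed.

(** Both sides are the expectation of the conditional probability of [b] at the
    random point [P]: on the left through the joint density, on the right
    factored by independence. *)
Lemma unconditional_prob_prod {R : realType} q d (T : measurableType d)
    (Pr : probability T R) (P : 'I_q -> {RV Pr >-> R}) (f : q.-tuple R -> R)
    (b : scenario q) :
  mutually_independent P ->
  has_density Pr (lebesgue_tuple q) (fun w => [tuple P c w | c < q]) f ->
  unconditional_prob f b =
  fine (\prod_(c < q) \int[Pr]_w (selection_factor (b c) (P c w))%:E)%E.
Proof.
move=> indP fP.
rewrite -(@integral_prod_independent _ _ _ _ _ _ (selection_factor \o b)
  indP)/=; last 2 first.
- by move=> c; exact: measurable_selection_factor.
- by move=> c t; exact: selection_factor_ge0.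
pose G (p : q.-tuple R) := \prod_(c < q) selection_factor (b c) (tnth p c).
rewrite /unconditional_prob Rintegral_mkcond /Rintegral; congr fine.
transitivity (\int[lebesgue_tuple q]_p (G p * f p)%:E)%E.
  apply: eq_integral => p _; congr EFin; rewrite patchE /G.
  case: ifPn => [/set_mem cp|ncp].
    congr (_ * _); apply: eq_bigr => c _.
    by rewrite /selection_factor patchE mem_set//= in_itv/=; exact: cp.
  have [c nc] : exists c, ~ (0 <= tnth p c <= 1).
    by apply/existsNP => cp; move/negP: ncp; apply; exact/mem_set.
  by rewrite (bigD1 c)//= /selection_factor patchE memNset ?mul0r//= in_itv.
rewrite -(integral_density _ fP).
- apply: eq_integral => w _; congr EFin; apply: eq_bigr => c _.
  by rewrite tnth_mktuple.
- apply/measurable_fun_tnthP => c.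
  rewrite (_ : _ \o _ = P c).
    exact: (@measurable_funPT _ _ _ _ (P c)).
  by apply/funext => w /=; rewrite tnth_mktuple.
- apply: measurable_prod => c _.
  exact: (measurableT_comp (measurable_selection_factor _) (measurable_tnth _)).
- by move=> p; apply: prodr_ge0 => c _; exact: selection_factor_ge0.
Qed.

Theorem proposition4p4 (R : realType)
    (* DEA data: [m] inputs and [s] outputs of [n] units, evaluated unit [o] *)
    (m s n : nat) (x : 'M[R]_(m, n)) (y : 'M[R]_(s, n)) (o : 'I_n)
    (x_ge0 : forall i j, 0 <= x i j) (y_ge0 : forall r j, 0 <= y r j)
    (* the candidate variables *)
    (q : nat) (q_gt0 : (0 < q)%N)
    (z : 'I_q -> 'I_m + 'I_s) (z_inj : injective z)
    (* the random selection probabilities *)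
    (alpha gamma : 'I_q -> R)
    (alpha_gt0 : forall c, 0 < alpha c) (gamma_gt0 : forall c, 0 < gamma c)
    (d : measure_display) (T : measurableType d) (Pr : probability T R)
    (P : 'I_q -> {RV Pr >-> R})
    (P_indep : mutually_independent P)
    (P_beta : forall c,
      has_density Pr lebesgue_measure (P c) (beta_density (alpha c) (gamma c)))
    (* a joint density of [P] *)
    (f : q.-tuple R -> R)
    (f_density : has_density Pr (lebesgue_tuple q)
      (fun w => [tuple P c w | c < q]) f) :
  expected_score f (dea_score x y o z) =
  \sum_(b : scenario q)
    (\prod_(c < q) alpha c ^+ b c * \prod_(c < q) gamma c ^+ (1 - b c))
    / (\prod_(c < q) (alpha c + gamma c)) * dea_score x y o z b.
Proof.
move=> *; apply: eq_bigr => b _; rewrite mulrC; congr (_ * _).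
rewrite (unconditional_prob_prod b P_indep f_density).
under eq_bigr do rewrite (beta_moment _ (alpha_gt0 _) (gamma_gt0 _) (P_beta _)).
rewrite -(big_morph _ (@EFinM R) erefl)/=.
by rewrite -!big_split/= prodf_div.
Qed.
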